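(* Let $M$ be an $F$-anti invariant submanifold in an arbitrary Kähler product manifold $\overline{M}^m\times\overline{M}^n$. If $s\equiv 0$, then $M$ is totally geodesic.
   Context: $\overline{M}^m$ and $\overline{M}^n$ are Kähler manifolds of complex dimensions $m$ and $n$ (no curvature assumption), and $\overline{M}=\overline{M}^m\times\overline{M}^n$ carries the product metric $g$ and product complex structure. $F=\overline{P}-\overline{Q}$ is the almost product structure on $\overline{M}$, where $\overline{P},\overline{Q}$ are the projections of $T\overline{M}$ onto the tangent spaces of the first and second factor. $M$ is a real submanifold of $\overline{M}$ with induced metric; it is $F$-anti invariant if $F(T_xM)\subset T_x(M)^\bot$ for all $x\in M$. For $V$ normal to $M$, $FV=tV+sV$ with $tV$ the tangential and $sV$ the normal part of $FV$. Totally geodesic means the second fundamental form $B$ of $M$ in $\overline{M}$ vanishes. *)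

(* Defs.v *)
From HB Require Import structures.
From mathcomp Require Import all_boot all_order all_algebra.
From mathcomp Require Import all_classical all_reals all_analysis.
Set Implicit Arguments.
Unset Strict Implicit.
Unset Printing Implicit Defensive.
Import Order.TTheory GRing.Theory Num.Theory.
Import numFieldNormedType.Exports.
Local Open Scope classical_set_scope.
Local Open Scope ring_scope.

(* MathComp-Analysis has no manifolds; the notions below are the classical ones,
   written in charts with values in the row vectors 'rV[R]_d.

   Tangent vectors: every point x of a manifold carries a preferred chart
   [chart_at x] of the atlas, and T_xM is identified with 'rV[R]_d through the
   components in that chart.  Consequently the differential, the metric,
   the connection, etc. at x are expressed in [chart_at x]; tangent vectors are
   moved to and from another chart c by the differential of the transition map
   ([in_chart], [of_chart]). *)

Section Smooth.
Context {R : realType}.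

(* On an open U of a finite-dimensional space this is the usual class C^k:
   all the iterated directional derivatives of order <= k exist and are
   continuous. *)
Fixpoint Ck (k : nat) (d : nat) (W : normedModType R)
    (U : set 'rV[R]_d) (f : 'rV[R]_d -> W) : Prop :=
  if k is k'.+1 then
    (forall x, U x -> differentiable f x) /\
    (forall v, Ck k' U (fun x => 'd f x v))
  else forall x, U x -> {for x, continuous f}.

Definition smooth_on (d : nat) (W : normedModType R)
    (U : set 'rV[R]_d) (f : 'rV[R]_d -> W) : Prop := forall k, Ck k U f.

End Smooth.

Section Manifold.
Variable R : realType.

(* Only the values of [chart_map] on [chart_dom], and of [chart_inv] on
   [chart_cod], are meaningful. *)
Record chart (T : Type) (d : nat) := Chart {
  chart_dom : set T;
  chart_map : T -> 'rV[R]_d;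
  chart_inv : 'rV[R]_d -> T }.

Definition chart_cod T d (c : chart T d) : set 'rV[R]_d :=
  chart_map c @` chart_dom c.

Definition is_chart (T : topologicalType) d (c : chart T d) : Prop :=
  [/\ open (chart_dom c), open (chart_cod c),
      forall x, chart_dom c x -> chart_inv c (chart_map c x) = x,
      forall x, chart_dom c x -> {for x, continuous (chart_map c)} &
      forall z, chart_cod c z -> {for z, continuous (chart_inv c)}].

Definition overlap T d (c c' : chart T d) : set 'rV[R]_d :=
  chart_map c @` (chart_dom c `&` chart_dom c').

Definition transition T d (c c' : chart T d) : 'rV[R]_d -> 'rV[R]_d :=
  fun z => chart_map c' (chart_inv c z).

Record charted_space (d : nat) := ChartedSpace {
  space :> topologicalType;
  atlas : set (chart space d);
  chart_at : space -> chart space d }.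

Arguments atlas {d} c _.

Definition is_manifold d (M : charted_space d) : Prop :=
  [/\ hausdorff_space M, @second_countable M,
      forall c, atlas M c -> is_chart c,
      forall x : M, atlas M (chart_at x) /\ chart_dom (chart_at x) x &
      forall c c', atlas M c -> atlas M c' ->
        smooth_on (overlap c c') (transition c c')].

Section Tangent.
Variables (d : nat) (M : charted_space d).

Definition coord (x : M) : 'rV[R]_d := chart_map (chart_at x) x.

Definition in_chart (c : chart M d) (x : M) (v : 'rV[R]_d) : 'rV[R]_d :=
  'd (transition (chart_at x) c) (coord x) v.

Definition of_chart (c : chart M d) (z v : 'rV[R]_d) : 'rV[R]_d :=
  'd (transition c (chart_at (chart_inv c z))) z v.

Definition vector_field := M -> 'rV[R]_d.

Definition smooth_field_on (U : set M) (X : vector_field) : Prop :=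
  forall c, atlas M c ->
    smooth_on (chart_map c @` (U `&` chart_dom c))
      (fun z => in_chart c (chart_inv c z) (X (chart_inv c z))).

End Tangent.

Record riem_space (d : nat) := RiemSpace {
  base :> charted_space d;
  metric : base -> 'rV[R]_d -> 'rV[R]_d -> R }.

Section Riemannian.
Variables (d : nat) (M : riem_space d).

Definition metric_in (c : chart M d) (z u v : 'rV[R]_d) : R :=
  metric (chart_inv c z) (of_chart c z u) (of_chart c z v).

Definition is_riemannian : Prop :=
  [/\ is_manifold M,
      forall (x : M) a u v w,
        metric x (a *: u + v) w = a * metric x u w + metric x v w,
      forall (x : M) u v, metric x u v = metric x v u,
      forall (x : M) u, u != 0 -> 0 < metric x u u &
      forall c, atlas M c -> forall u v,
        smooth_on (chart_cod c) (fun z => metric_in c z u v)].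

(* The value at z, in the chart c, of the Levi-Civita derivative of the
   coordinate field v along the coordinate field u (constant components):
   it is characterized by the Koszul formula, where brackets vanish. *)
Definition christoffel (c : chart M d) (z u v : 'rV[R]_d) : 'rV[R]_d :=
  xget 0 [set a | forall w, metric_in c z a w =
    2^-1 * ('d (fun y => metric_in c y v w) z u
          + 'd (fun y => metric_in c y u w) z v
          - 'd (fun y => metric_in c y u v) z w)].

End Riemannian.

(* Multiplication by i on C^m, where x + iy is encoded as row_mx x y. *)
Definition mulI (m : nat) (v : 'rV[R]_(m + m)) : 'rV[R]_(m + m) :=
  row_mx (- rsubmx v) (lsubmx v).

Definition kahler_form_in m (M : riem_space (m + m)) (c : chart M (m + m))
    (z u v : 'rV[R]_(m + m)) : R := metric_in c z (mulI u) v.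

(* Kaehler manifold of complex dimension m: the transition maps are holomorphic
   (their differentials are C-linear), so that mulI, read in any chart, is the
   complex structure; the metric is Hermitian and its fundamental 2-form is
   closed. *)
Definition is_kahler m (M : riem_space (m + m)) : Prop :=
  [/\ is_riemannian M,
      forall c c', atlas M c -> atlas M c' ->
        forall z, overlap c c' z -> forall v,
        'd (transition c c') z (mulI v) = mulI ('d (transition c c') z v),
      forall (x : M) u v, metric x (mulI u) (mulI v) = metric x u v &
      forall c, atlas M c -> forall z, chart_cod c z -> forall u v w,
        'd (fun y => kahler_form_in c y v w) z u
        + 'd (fun y => kahler_form_in c y w u) z v
        + 'd (fun y => kahler_form_in c y u v) z w = 0].

Section Product.
Variables (d1 d2 : nat).

Definition prod_chart T1 T2 (c1 : chart T1 d1) (c2 : chart T2 d2) :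
    chart (T1 * T2) (d1 + d2) :=
  {| chart_dom := chart_dom c1 `*` chart_dom c2;
     chart_map := fun x => row_mx (chart_map c1 x.1) (chart_map c2 x.2);
     chart_inv := fun z => (chart_inv c1 (lsubmx z), chart_inv c2 (rsubmx z)) |}.

Definition prod_charted (M1 : charted_space d1) (M2 : charted_space d2) :
    charted_space (d1 + d2) :=
  {| space := (M1 * M2)%type;
     atlas := [set c | exists c1 c2,
       [/\ atlas M1 c1, atlas M2 c2 & c = prod_chart c1 c2]];
     chart_at := fun x => prod_chart (chart_at x.1) (chart_at x.2) |}.

(* T_(x1,x2)(M1 x M2) is T_x1 M1 (+) T_x2 M2, the summands being the blocks of
   the row vectors. *)
Definition prod_riem (M1 : riem_space d1) (M2 : riem_space d2) :
    riem_space (d1 + d2) :=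
  {| base := prod_charted M1 M2;
     metric := fun x u v =>
       metric x.1 (lsubmx u) (lsubmx v) + metric x.2 (rsubmx u) (rsubmx v) |}.

Definition projP (u : 'rV[R]_(d1 + d2)) : 'rV[R]_(d1 + d2) :=
  row_mx (lsubmx u) 0.
Definition projQ (u : 'rV[R]_(d1 + d2)) : 'rV[R]_(d1 + d2) :=
  row_mx 0 (rsubmx u).
Definition almost_product (u : 'rV[R]_(d1 + d2)) : 'rV[R]_(d1 + d2) :=
  projP u - projQ u.

End Product.

Section Map.
Variables (k d : nat) (M : charted_space k) (N : charted_space d) (f : M -> N).

Definition map_in (c : chart M k) (e : chart N d) (z : 'rV[R]_k) : 'rV[R]_d :=
  chart_map e (f (chart_inv c z)).

Definition smooth_map : Prop :=
  continuous f /\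
  forall c e, atlas M c -> atlas N e ->
    smooth_on (chart_map c @` (chart_dom c `&` f @^-1` chart_dom e))
      (map_in c e).

Definition tmap (x : M) (u : 'rV[R]_k) : 'rV[R]_d :=
  'd (map_in (chart_at x) (chart_at (f x))) (coord x) u.

Definition immersion : Prop := smooth_map /\ forall x, injective (tmap x).

End Map.

(* A submanifold of N is given by an immersion f : M -> N; M has the induced
   metric, and T_xM is identified with its image under tmap f x. *)
Section Submanifold.
Variables (k d : nat) (M : charted_space k) (N : riem_space d) (f : M -> N).

Definition is_tangent (x : M) (w : 'rV[R]_d) : Prop := exists u, w = tmap f x u.

Definition is_normal (x : M) (w : 'rV[R]_d) : Prop :=
  forall u, metric (f x) w (tmap f x u) = 0.

Definition tan_part (x : M) (w : 'rV[R]_d) : 'rV[R]_d :=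
  xget 0 [set t | is_tangent x t /\ is_normal x (w - t)].

Definition nor_part (x : M) (w : 'rV[R]_d) : 'rV[R]_d := w - tan_part x w.

(* Levi-Civita derivative of N of the field f_* Y along f, in the direction of
   f_* X, at x. *)
Definition ambient_deriv (X Y : vector_field M) (x : M) : 'rV[R]_d :=
  let c := chart_at x in
  let e := chart_at (f x) in
  let fY := fun z : 'rV[R]_k =>
    'd (map_in f c e) z (in_chart c (chart_inv c z) (Y (chart_inv c z))) in
  'd fY (coord x) (X x)
  + christoffel e (coord (f x)) (tmap f x (X x)) (tmap f x (Y x)).

Definition second_fundamental_form (X Y : vector_field M) (x : M) : 'rV[R]_d :=
  nor_part x (ambient_deriv X Y x).

Definition totally_geodesic : Prop :=
  forall (U : set M) (X Y : vector_field M),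
    open U -> smooth_field_on U X -> smooth_field_on U Y ->
    forall x, U x -> second_fundamental_form X Y x = 0.

End Submanifold.

Section ProductSubmanifold.
Variables (k d1 d2 : nat) (M : charted_space k).
Variables (M1 : riem_space d1) (M2 : riem_space d2).
Variable f : M -> prod_riem M1 M2.

Definition F_anti_invariant : Prop :=
  forall x w, is_tangent f x w -> is_normal f x (almost_product w).

Definition t_part (x : M) (V : 'rV[R]_(d1 + d2)) : 'rV[R]_(d1 + d2) :=
  tan_part f x (almost_product V).

Definition s_part (x : M) (V : 'rV[R]_(d1 + d2)) : 'rV[R]_(d1 + d2) :=
  nor_part f x (almost_product V).

End ProductSubmanifold.

End Manifold.

(* Main.v *)
Require Import Defs.
From HB Require Import structures.
From mathcomp Require Import all_boot all_order all_algebra.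
From mathcomp Require Import all_classical all_reals all_analysis.
From mathcomp Require Import lra.
Set Implicit Arguments.
Unset Strict Implicit.
Unset Printing Implicit Defensive.
Import Order.TTheory GRing.Theory Num.Theory.
Import numFieldNormedType.Exports.
Local Open Scope classical_set_scope.
Local Open Scope ring_scope.

(* Let F be the almost product structure and H(u, v) = g(F u, v), that is
   H = g1 - g2 on the product M1 x M2.  In product charts the Levi-Civita
   connection of g also satisfies the Koszul identity for H.  F-anti invariance
   says that f pulls H back to 0; expressing the Koszul expression of f^*H = 0
   through f, with the symmetry of the second derivatives of f in charts, gives
   H(D_X f_*Y, f_*Z) = 0 for all Z, so F (D_X f_*Y) is normal.  Since s = 0, F maps
   it to a tangent vector, which is D_X f_*Y because F is an involution. *)

(** * Differentials *)

Section Calculus.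
Context {R : realType}.
Implicit Types V W : normedModType R.

Lemma is_diff_sum V W n (f df : 'I_n -> V -> W) (x : V) :
  (forall i, is_diff x (f i) (df i)) ->
  is_diff x (fun y => \sum_i f i y) (fun u => \sum_i df i u).
Proof.
elim: n f df => [|n IHn] f df fx.
  under eq_fun do rewrite big_ord0.
  under [X in is_diff _ _ X]eq_fun do rewrite big_ord0.
  exact: is_diff_cst.
under eq_fun do rewrite big_ord_recl.
under [X in is_diff _ _ X]eq_fun do rewrite big_ord_recl.
by apply: is_diffD; exact: IHn.
Qed.

(** Finite dimension is what matters: in the standard basis the map is a finite sum of coordinate
    functions times constant vectors. *)
Lemma linear_rV_continuous n W (f : {linear 'rV[R]_n -> W}) : continuous f.
Proof.
have -> : (f : _ -> _) = fun v => \sum_j v 0 j *: f (delta_mx 0 j).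
  apply/funext => v; rewrite {1}(row_sum_delta v) linear_sum.
  by apply: eq_bigr => j _; rewrite linearZ.
move=> v; apply: differentiable_continuous.
pose F j (u : 'rV[R]_n) := u 0 j *: f (delta_mx 0 j).
suff Fd : is_diff v (fun u => \sum_j F j u) (fun u => \sum_j 'd (F j) v u) by [].
apply: is_diff_sum => j.
by apply/differentiableP/differentiableZl/differentiable_coord.
Qed.

(** A differential depends only on the germ of the function. Chart maps are meaningful only on their
    domains, so identities between their composites hold only near a point. *)
Lemma near_eq_is_diff V W (f g df : V -> W) (x : V) :
  (\forall y \near x, f y = g y) -> is_diff x f df -> is_diff x g df.
Proof.
move=> fg [dfx <-].
have gE : g \o shift x = cst (g x) + 'd f x +o_ 0 id.
  have /eqaddoP fo := diff_locally dfx.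
  apply/eqaddoP => e e0; have := fo _ e0.
  have : \forall y \near 0, f (y + x) = g (y + x).
    by move: (fg); rewrite (near_shift 0)/= subr0.
  by apply: filterS2 => y /= fgy; rewrite !fctE/= fgy (nbhs_singleton fg).
have dg : 'd g x = 'd f x :> (V -> W).
  by apply: diff_unique => //; exact: diff_continuous.
apply: DiffDef => //; apply/diff_locallyP; rewrite dg; split => //.
exact: diff_continuous.
Qed.

Lemma is_diff_linear n W (L : {linear 'rV[R]_n -> W}) x : is_diff x L L.
Proof.
have Lc := @linear_rV_continuous _ _ L.
by apply: DiffDef; [exact: linear_differentiable|exact: diff_lin].
Qed.

Lemma is_diff_scale V W (k dk : V -> R) (f df : V -> W) x :
  is_diff x k dk -> is_diff x f df ->
  is_diff x (fun y => k y *: f y) (fun u => k x *: df u + dk u *: f x).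
Proof.
move=> dkx dfx.
have sl (w : W) : linear ( *:%R ^~ w : R -> W).
  by move=> a b c; rewrite scalerDl scalerA.
have sr (a : R) : linear ( *:%R a : W -> W).
  by move=> b c d; rewrite scalerDr !scalerA mulrC.
(* Scaling is packaged as a continuous bilinear map, which turns the product rule into the chain
   rule. *)
pose sM := bilinear_isBilinear.Build R R W W _ _ ( *:%R : R -> W -> W) (conj sl sr).
pose sB : {bilinear R -> W -> W} := HB.pack ( *:%R : R -> W -> W) sM.
have sc : continuous (fun p : R * W => sB p.1 p.2) by exact: scale_continuous.
have sd : is_diff (k x, f x) (fun p => sB p.1 p.2)
    (fun q => sB (k x) q.2 + sB q.1 (f x)).
  by apply: DiffDef; [exact: differentiable_bilin|exact: diff_bilin].
exact: is_diff_comp (is_diff_pair dkx dfx) sd.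
Qed.

Lemma is_diff_coord V n (f df : V -> 'rV[R]_n) x j :
  is_diff x f df -> is_diff x (fun y => f y 0 j) (fun u => df u 0 j).
Proof.
move=> fx.
have cl : linear (fun v : 'rV[R]_n => v 0 j : R) by move=> a u v; rewrite !mxE.
pose cM := GRing.isLinear.Build _ _ _ _ _ cl.
pose cL : {linear 'rV[R]_n -> R} := HB.pack (fun v : 'rV[R]_n => v 0 j) cM.
exact: (is_diff_comp fx (is_diff_linear cL (f x))).
Qed.

(** Product rule for a linear map that varies with [y]. Differentiability is asked only at each
    fixed argument; expanding [a y] in the standard basis reduces the claim to finitely many
    products. *)
Lemma is_diff_linear_family V n W (L : V -> 'rV[R]_n -> W)
    (a da : V -> 'rV[R]_n) x :
  (forall y, linear (L y)) ->
  (forall v, differentiable (L ^~ v) x) -> is_diff x a da ->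
  is_diff x (fun y => L y (a y)) (fun u => 'd (L ^~ (a x)) x u + L x (da u)).
Proof.
move=> Ll Ld ax.
have LE y v : L y v = \sum_j v 0 j *: L y (delta_mx 0 j).
  pose LM := GRing.isLinear.Build _ _ _ _ _ (Ll y).
  pose LL : {linear 'rV[R]_n -> W} := HB.pack (L y) LM.
  rewrite -[L y]/(LL : _ -> _) {1}(row_sum_delta v) linear_sum.
  by apply: eq_bigr => j _; rewrite linearZ.
have Lj j : is_diff x (L ^~ (delta_mx 0 j)) ('d (L ^~ (delta_mx 0 j)) x).
  exact: differentiableP.
have -> : (fun y => L y (a y)) = fun y => \sum_j a y 0 j *: L y (delta_mx 0 j).
  by apply/funext => y; rewrite LE.
have dLa u : 'd (L ^~ (a x)) x u
    = \sum_j a x 0 j *: 'd (L ^~ (delta_mx 0 j)) x u.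
  have : is_diff x (fun y => \sum_j a x 0 j *: L y (delta_mx 0 j))
      (fun u => \sum_j a x 0 j *: 'd (L ^~ (delta_mx 0 j)) x u).
    by apply: is_diff_sum => j; exact: is_diffZ.
  rewrite (_ : (fun y => _) = L ^~ (a x)); last by apply/funext => y; rewrite [RHS]LE.
  by case=> _ ->.
apply: (is_diff_eq (is_diff_sum (fun j => is_diff_scale (is_diff_coord j ax) (Lj j)))).
by apply/funext => u; rewrite big_split/= dLa [in RHS]LE.
Qed.

(** Restriction to the segment from [z] to [z + h *: v] gives the mean value theorem in one
    variable. *)
Lemma mean_value_direction V (g dg : V -> R) (z v : V) (h : R) : 0 < h ->
  (forall t, 0 <= t <= h ->
    differentiable g (z + t *: v) /\ 'd g (z + t *: v) v = dg (z + t *: v)) ->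
  exists2 t, 0 <= t <= h & g (z + h *: v) - g z = h * dg (z + t *: v).
Proof.
move=> h0 gd.
have gt t : 0 <= t <= h ->
    is_derive t 1 (fun s : R => g (z + s *: v)) (dg (z + t *: v)).
  move=> th; have [gz <-] := gd _ th.
  have cz : is_diff t (fun s : R => z + s *: v) (fun s : R => s *: v).
    by apply: is_diff_eq; apply/funext => s; rewrite /= !fctE add0r.
  have := is_diff_comp cz (differentiableP gz); rewrite /comp => -[d1 d2].
  apply: DeriveDef; first exact: diff_derivable.
  by rewrite deriveE// d2 scale1r.
have gc : {within `[0, h], continuous (fun s : R => g (z + s *: v))}.
  apply: derivable_within_continuous => t th; apply: ex_derive.
  by apply: gt; rewrite !(itvP th).
have [|t th gE] := @MVT R _ (fun t => dg (z + t *: v)) 0 h h0 _ gc.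
  by move=> t th; apply: gt; rewrite !ltW ?(itvP th).
exists t; first by rewrite !ltW ?(itvP th).
by move: gE; rewrite scale0r addr0 subr0 mulrC.
Qed.

(** The mean value theorem is used twice: along [v] for the increment of [g] by [h *: w], then along
    [w] for the derivative [a]. *)
Lemma second_difference V (g a b : V -> R) (z v w : V) (h : R) : 0 < h ->
  (forall s t, 0 <= s <= h -> 0 <= t <= h -> let y := z + s *: v + t *: w in
    [/\ differentiable g y, 'd g y v = a y, differentiable a y & 'd a y w = b y]) ->
  exists s t, [/\ 0 <= s <= h, 0 <= t <= h &
    g (z + h *: v + h *: w) - g (z + h *: v) - (g (z + h *: w) - g z)
    = h * (h * b (z + s *: v + t *: w))].
Proof.
move=> h0 gd.
have h00 : 0 <= (0 : R) <= h by rewrite lexx ltW.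
have hhh : 0 <= h <= h by rewrite ltW/=.
have gwd s : 0 <= s <= h ->
    differentiable (fun y => g (y + h *: w) - g y) (z + s *: v) /\
    'd (fun y => g (y + h *: w) - g y) (z + s *: v) v
      = a (z + s *: v + h *: w) - a (z + s *: v).
  move=> sh; have [g1 <- _ _] := gd s h sh hhh.
  have [] := gd s 0 sh h00; rewrite scale0r addr0 => g2 <- _ _.
  have sd : is_diff (z + s *: v) (fun y => y + h *: w) id.
    by apply: is_diff_eq; apply/funext => y; rewrite !fctE addr0.
  have [d1 d2] := is_diffB (is_diff_comp sd (differentiableP g1)) (differentiableP g2).
  by split; [exact: d1|rewrite (congr1 (fun f => f v) d2)].
have [s sh gE] := @mean_value_direction _ _
  (fun y => a (y + h *: w) - a y) _ _ _ h0 gwd.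
have [t th aE] : exists2 t, 0 <= t <= h & a (z + s *: v + h *: w) - a (z + s *: v)
    = h * b (z + s *: v + t *: w).
  by apply: mean_value_direction => // t th; have [] := gd s t sh th.
exists s, t; split => //.
by rewrite -aE -gE addrAC.
Qed.

(* Both mixed second derivatives are limits of the same second difference. *)
Lemma second_derivatives_commute V (g a1 a2 b1 b2 : V -> R) (z v w : V) :
  (\forall y \near z, [/\ differentiable g y, 'd g y v = a1 y & 'd g y w = a2 y]) ->
  (\forall y \near z, differentiable a1 y /\ 'd a1 y w = b1 y) ->
  (\forall y \near z, differentiable a2 y /\ 'd a2 y v = b2 y) ->
  {for z, continuous b1} -> {for z, continuous b2} -> b1 z = b2 z.
Proof.
move=> gn an1 an2 c1 c2.
apply/eqP; rewrite -subr_eq0 -normr_le0; apply/ler_addgt0Pr => e e0; rewrite add0r.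
have e20 : 0 < e / 2 by rewrite divr_gt0.
have /cvgrPdist_lt/(_ _ e20) n1 := c1.
have /cvgrPdist_lt/(_ _ e20) n2 := c2.
have /nbhs_normP[r /= r0 rB] : \forall y \near z,
   [/\ differentiable g y, 'd g y v = a1 y & 'd g y w = a2 y] /\
   [/\ differentiable a1 y, 'd a1 y w = b1 y, differentiable a2 y & 'd a2 y v = b2 y] /\
   (`|b1 z - b1 y| < e / 2 /\ `|b2 z - b2 y| < e / 2).
  near=> y; split; [near: y; exact: gn|split].
    have [] : differentiable a1 y /\ 'd a1 y w = b1 y by near: y.
    by have [] : differentiable a2 y /\ 'd a2 y v = b2 y by near: y.
  by split; near: y.
(* With this [h] the whole parallelogram of sides [h *: v] and [h *: w] stays within distance
   [r / 2] of [z]. *)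
pose h := r / 2 / (1 + `|v| + `|w|).
have N0 : 0 < 1 + `|v| + `|w| by rewrite -addrA ltr_pwDl// addr_ge0.
have h0 : 0 < h by rewrite !divr_gt0.
have inB s t : 0 <= s <= h -> 0 <= t <= h -> `|z - (z + s *: v + t *: w)| < r.
  move=> /andP[s0 sh] /andP[t0 th].
  rewrite -addrA opprD addrA subrr sub0r normrN.
  rewrite (le_lt_trans (ler_normD _ _))// !normrZ !ger0_norm//.
  have : s * `|v| + t * `|w| <= h * (1 + `|v| + `|w|).
    rewrite -addrA mulrDr mulr1 mulrDr -[leLHS]add0r lerD ?(ltW h0)//.
    by rewrite lerD// ler_wpM2r.
  move=> /le_lt_trans; apply; rewrite /h mulfVK ?gt_eqF//.
  by rewrite ltr_pdivrMr// ltr_pMr// ltr1n.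
have [s1 [t1 [s1h t1h E1]]] := @second_difference V g a1 b1 z v w h h0
  (fun s t sh th => let: conj (And3 d e _) (conj (And4 d1 e1 _ _) _) := rB _ (inB s t sh th)
    in And4 d e d1 e1).
have [s2 [t2 [s2h t2h E2]]] := @second_difference V g a2 b2 z w v h h0
  (fun s t sh th => ltac:(by rewrite /= addrAC; case: (rB _ (inB t s th sh)) => -[? ? ?] [[]])).
(* The second difference is symmetric in [v] and [w], so its two mean-value forms agree, and the
   factor [h] cancels twice. *)
have E : b1 (z + s1 *: v + t1 *: w) = b2 (z + s2 *: w + t2 *: v).
  have : h * (h * b1 (z + s1 *: v + t1 *: w)) = h * (h * b2 (z + s2 *: w + t2 *: v)).
    rewrite -E1 -E2 [z + _ + _ in RHS]addrAC.
    by rewrite !opprB addrACA [RHS]addrACA; congr (_ + _); exact: addrC.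
  by move=> /(mulfI (lt0r_neq0 h0))/(mulfI (lt0r_neq0 h0)).
have [_ [_ [B1 _]]] := rB _ (inB _ _ s1h t1h).
have [_ [_ [_ B2]]] := rB _ (inB _ _ t2h s2h).
rewrite addrAC -E in B2.
rewrite -(subrKA (b1 (z + s1 *: v + t1 *: w))) (le_trans (ler_normD _ _))//.
by rewrite [leRHS]splitr lerD// ltW// distrC.
Unshelve. all: by end_near. Qed.

End Calculus.

(** * The Koszul expression *)

Section Koszul.
Context {R : realType}.

(** The equality of mixed derivatives, applied to each coordinate of [phi]; order 2 of [Ck] supplies
    the continuity of the second derivatives. *)
Lemma hessian_sym k d (phi : 'rV[R]_k -> 'rV[R]_d) (N : set 'rV[R]_k) z u v :
  (\forall y \near z, N y) -> Ck 2 N phi ->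
  'd (fun y => 'd phi y v) z u = 'd (fun y => 'd phi y u) z v.
Proof.
move=> Nz [phid /= phidd].
apply/rowP => j.
apply: (@second_derivatives_commute _ _ (fun y => phi y 0 j)
  (fun y => 'd phi y v 0 j) (fun y => 'd phi y u 0 j)
  (fun y => 'd (fun y => 'd phi y v) y u 0 j)
  (fun y => 'd (fun y => 'd phi y u) y v 0 j) z v u).
- apply: filterS Nz => y Ny.
  by have [? ->] := is_diff_coord j (differentiableP (phid y Ny)).
- apply: filterS Nz => y Ny.
  by have [? ->] := is_diff_coord j (differentiableP ((phidd v).1 y Ny)).
- apply: filterS Nz => y Ny.
  by have [? ->] := is_diff_coord j (differentiableP ((phidd u).1 y Ny)).
- have c := (phidd v).2 u z (nbhs_singleton Nz).
  exact: (continuous_comp c (@coord_continuous _ _ _ 0 j _)).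
- have c := (phidd u).2 v z (nbhs_singleton Nz).
  exact: (continuous_comp c (@coord_continuous _ _ _ 0 j _)).
Qed.

(** Twice the Christoffel symbol of the first kind, for fields with constant components, whose
    brackets vanish. It is stated for any field of forms [H], so that it covers the indefinite form
    g1 - g2 as well as the metric. *)
Definition koszul d (H : 'rV[R]_d -> 'rV[R]_d -> 'rV[R]_d -> R)
    (y u v w : 'rV[R]_d) : R :=
  'd (fun y => H y v w) y u + 'd (fun y => H y u w) y v
  - 'd (fun y => H y u v) y w.

(* If [phi] pulls [H] back to 0, the second derivative of [phi] plays the role of
   minus the Christoffel symbols of [H] when paired with the image of ['d phi]. *)
Lemma koszul_isotropic k d (H : 'rV[R]_d -> 'rV[R]_d -> 'rV[R]_d -> R)
    (phi : 'rV[R]_k -> 'rV[R]_d) (z u v w : 'rV[R]_k) :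
  (forall y p, linear (fun q => H y q p : R)) ->
  (forall y p q, H y p q = H y q p) ->
  (forall p q, differentiable (fun y => H y p q) (phi z)) ->
  differentiable phi z ->
  (forall p, differentiable (fun y => 'd phi y p) z) ->
  (forall p q, 'd (fun y => 'd phi y q) z p = 'd (fun y => 'd phi y p) z q) ->
  (forall p q, \forall y \near z, H (phi y) ('d phi y p) ('d phi y q) = 0) ->
  2 * H (phi z) ('d (fun y => 'd phi y v) z u) ('d phi z w)
  + koszul H (phi z) ('d phi z u) ('d phi z v) ('d phi z w) = 0.
Proof.
move=> Hl Hs Hd phid phidd sym null.
have Hr y p : linear (fun q => H y p q : R).
  by move=> a q q'; rewrite !(Hs y p); exact: Hl.
pose T p q r :=
  'd (fun y => H y ('d phi z q) ('d phi z r)) (phi z) ('d phi z p).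
pose D2 p q := 'd (fun y => 'd phi y q) z p.
(* The derivative of the vanishing pullback in the direction [p]: one term from the base point of
   [H] and one from each argument. *)
have D p q r : T p q r + H (phi z) (D2 p q) ('d phi z r)
    + H (phi z) ('d phi z q) (D2 p r) = 0.
  have Hphi a b : is_diff z (fun y => H (phi y) a b)
      (fun c => 'd (fun y => H y a b) (phi z) ('d phi z c)).
    exact: is_diff_comp (differentiableP phid) (differentiableP (Hd a b)).
  have H1 b := @is_diff_linear_family _ _ _ _ (fun y a => H (phi y) a b) _ _ z
    (fun y => Hl _ _) (fun a => @ex_diff _ _ _ _ _ _ _ (Hphi a b)) (differentiableP (phidd q)).
  have H2 := @is_diff_linear_family _ _ _ _ (fun y b => H (phi y) ('d phi y q) b) _ _ z
    (fun y => Hr _ _) (fun b => @ex_diff _ _ _ _ _ _ _ (H1 b)) (differentiableP (phidd r)).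
  have H0 := near_eq_is_diff (null q r) H2.
  have := diff_cst (0 : R) z; rewrite /cst.
  have [_ ->] := H0 => /(congr1 (fun f => f p)).
  have [_ /= ->] := H1 ('d phi z r).
  by have [_ ->] := Hphi ('d phi z q) ('d phi z r).
have {}sym p q : D2 p q = D2 q p by exact: sym.
suff : 2 * H (phi z) (D2 u v) ('d phi z w)
    + (T u v w + T v u w - T w u v) = 0 by [].
move: (D u v w) (D v u w) (D w u v); clear D Hd phidd null; clearbody T D2.
move: ('d phi z u) ('d phi z v) ('d phi z w) => du dv dw.
(* In the combination D(u,v,w) + D(v,u,w) - D(w,u,v) the symmetries of [H] and [D2] cancel every
   second-derivative term except two copies of H(D2 u v, dw). *)
rewrite (Hs _ du (D2 v w)) (Hs _ dv (D2 u w)) (Hs _ du (D2 w v)).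
rewrite (sym v u) (sym w u) (sym w v).
lra.
Qed.

(** The Gram matrix [A] is invertible: a row vector [u] in its kernel has [B u u = 0], hence is
    zero. The representing vector solves the resulting linear system. *)
Lemma riesz_rV d (B : 'rV[R]_d -> 'rV[R]_d -> R) (K : 'rV[R]_d -> R) :
  (forall w, linear (fun u => B u w : R)) ->
  (forall u, linear (fun w => B u w : R)) ->
  (forall u, u != 0 -> B u u != 0) -> linear (K : _ -> R) ->
  exists a, forall w, B a w = K w.
Proof.
have expand (f : 'rV[R]_d -> R) : linear f ->
    forall v, f v = \sum_j v 0 j * f (delta_mx 0 j).
  move=> fl v; pose fM := GRing.isLinear.Build _ _ _ _ _ fl.
  pose F : {linear 'rV[R]_d -> R} := HB.pack f fM.
  rewrite -[f]/(F : _ -> _) {1}(row_sum_delta v) linear_sum.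
  by apply: eq_bigr => j _; rewrite linearZ.
move=> Bl Br Bn Kl.
pose A := \matrix_(i, j) B (delta_mx 0 i) (delta_mx 0 j).
have AE u j : (u *m A) 0 j = B u (delta_mx 0 j).
  rewrite mxE [RHS](expand (B^~ _))//.
  by apply: eq_bigr => i _; rewrite mxE.
have Au : A \in unitmx.
  rewrite -row_free_unit; apply: inj_row_free => u uA.
  apply/eqP/negPn/negP => /Bn/negP; apply; apply/eqP.
  rewrite (expand (B u))// big1// => j _.
  by rewrite -AE uA mxE mulr0.
exists ((\row_j K (delta_mx 0 j)) *m invmx A) => w.
rewrite (expand (B _))// (expand K)//; apply: eq_bigr => j _.
by rewrite -AE mulmxKV// mxE.
Qed.

End Koszul.

(** * Charts *)

Lemma open_setX (T1 T2 : topologicalType) (A : set T1) (B : set T2) :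
  open A -> open B -> open (A `*` B).
Proof.
move=> oA oB; rewrite openE => -[a b] [/= Aa Bb].
by exists (A, B) => //; split; exact: open_nbhs_nbhs.
Qed.

Section Charts.
Context {R : realType}.

Lemma chart_inv_cod (T : topologicalType) d (c : chart R T d) z :
  is_chart c -> chart_cod c z ->
  chart_dom c (chart_inv c z) /\ chart_map c (chart_inv c z) = z.
Proof. by case=> _ _ cK _ _ [x cx <-]; rewrite cK. Qed.

Lemma near_chart_inv (T : topologicalType) d (c : chart R T d) z (A : set T) :
  is_chart c -> chart_cod c z -> nbhs (chart_inv c z) A ->
  \forall y \near z, [/\ chart_cod c y, chart_dom c (chart_inv c y) & A (chart_inv c y)].
Proof.
move=> cc cz Az; have [_ oc _ _ /(_ z cz) ic] := cc.
have Ay : \forall y \near z, A (chart_inv c y) by exact: ic.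
have Cy : \forall y \near z, chart_cod c y by exact: open_nbhs_nbhs.
apply: filterS2 Cy Ay => y cy Ay; split => //.
by have [] := chart_inv_cod cc cy.
Qed.

(** [transition c c] is the identity on [chart_cod c], which is open, so its germ at [z] is that of
    the identity. *)
Lemma diff_transition_id (T : topologicalType) d (c : chart R T d) z u :
  is_chart c -> chart_cod c z -> 'd (transition c c) z u = u.
Proof.
move=> cc cz; have [_ oc _ _ _] := cc.
suff [_ ->] : is_diff z (transition c c) id by [].
apply: near_eq_is_diff (is_diff_id _).
have : \forall y \near z, chart_cod c y by exact: open_nbhs_nbhs.
by apply: filterS => y /(chart_inv_cod cc)[].
Qed.

Variables (k d : nat) (M : charted_space R k) (N : charted_space R d) (f : M -> N).
Hypothesis hM : is_manifold M.
Hypothesis hf : smooth_map f.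

Lemma map_in_smooth (c : chart R M k) (e : chart R N d) :
  atlas c -> atlas e -> forall j z,
  chart_cod c z -> open (chart_dom e) -> chart_dom e (f (chart_inv c z)) ->
  exists2 A, nbhs z A & Ck j A (map_in f c e).
Proof.
move=> ac ae j z cz oe efz; have [_ _ /(_ c ac) cc _ _] := hM.
have [fc /(_ c e ac ae j) fs] := hf.
exists (chart_map c @` (chart_dom c `&` f @^-1` chart_dom e)) => //.
have fe : nbhs (chart_inv c z) (f @^-1` chart_dom e).
  by apply: fc; exact: open_nbhs_nbhs.
apply: filterS (near_chart_inv cc cz fe) => y [cy dy ey].
by exists (chart_inv c y) => //; have [] := chart_inv_cod cc cy.
Qed.

Lemma map_in_differentiable (c : chart R M k) (e : chart R N d) z :
  atlas c -> atlas e ->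
  chart_cod c z -> open (chart_dom e) -> chart_dom e (f (chart_inv c z)) ->
  differentiable (map_in f c e) z.
Proof.
move=> ac ae cz oe efz.
have [A Az [fd _]] := map_in_smooth ac ae 1 cz oe efz.
exact: fd (nbhs_singleton Az).
Qed.

Lemma transition_differentiable (c c' : chart R M k) z : atlas c -> atlas c' ->
  chart_cod c z -> chart_dom c' (chart_inv c z) ->
  differentiable (transition c c') z.
Proof.
move=> ac ac' cz c'z; have [_ _ /(_ c ac) cc _ /(_ c c' ac ac' 1)[cs _]] := hM.
by apply: cs; exists (chart_inv c z); have [] := chart_inv_cod cc cz.
Qed.

(** Chart independence of the tangent map. Both sides are the differential at [z] of [f] read from
    [c] to the preferred chart at [f p], factored through a transition on the source or on the
    target. The conditions on [N] are listed separately so that a product can meet them through its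
    factors. *)
Lemma tmap_in_chart (c : chart R M k) (e : chart R N d) z u :
  atlas c -> atlas e -> chart_cod c z ->
  let p := chart_inv c z in
  (forall x : N, atlas (chart_at x) /\ chart_dom (chart_at x) x) ->
  open (chart_dom e) -> chart_dom e (f p) ->
  open (chart_dom (chart_at (f p))) ->
  (forall q, chart_dom e q -> chart_inv e (chart_map e q) = q) ->
  differentiable (transition e (chart_at (f p))) (map_in f c e z) ->
  tmap f p ('d (transition c (chart_at p)) z u)
  = 'd (transition e (chart_at (f p))) (map_in f c e z) ('d (map_in f c e) z u).
Proof.
move=> ac ae cz p aN oe ep oe' eK te.
have [_ _ aM /(_ p)[ac' c'p] _] := hM; have cc := aM _ ac.
have cc' := aM _ ac'; have [oc' _ c'K _ _] := cc'.
have [ae' e'p] := aN (f p).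
have fc := hf.1.
have tz : transition c (chart_at p) z = Defs.coord p by [].
have zE : chart_inv (chart_at p) (Defs.coord p) = p by rewrite /Defs.coord c'K.
have d1 : is_diff z (map_in f c (chart_at (f p)))
    ('d (map_in f (chart_at p) (chart_at (f p))) (Defs.coord p)
       \o 'd (transition c (chart_at p)) z).
  apply: (@near_eq_is_diff _ _ _
    (map_in f (chart_at p) (chart_at (f p)) \o transition c (chart_at p))).
    have : nbhs p (chart_dom (chart_at p)) by exact: open_nbhs_nbhs.
    move=> /(near_chart_inv cc cz); apply: filterS => y [_ _ yp] /=.
    by rewrite /map_in /transition c'K.
  apply: is_diff_comp; apply: differentiableP; first exact: transition_differentiable.
  by rewrite tz; apply: map_in_differentiable => //; [exists p|rewrite zE].
have d2 : is_diff z (map_in f c (chart_at (f p)))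
    ('d (transition e (chart_at (f p))) (map_in f c e z) \o 'd (map_in f c e) z).
  apply: (@near_eq_is_diff _ _ _ (transition e (chart_at (f p)) \o map_in f c e)).
    have : nbhs p (f @^-1` chart_dom e) by apply: fc; exact: open_nbhs_nbhs.
    move=> /(near_chart_inv cc cz); apply: filterS => y [_ _ yp] /=.
    by rewrite /map_in /transition eK.
  apply: is_diff_comp; apply: differentiableP => //.
  exact: map_in_differentiable.
have [_ /(congr1 (fun g => g u)) E1] := d1.
have [_ /(congr1 (fun g => g u)) E2] := d2.
exact: etrans (esym E1) E2.
Qed.

End Charts.

(** * Block bilinear forms *)

Lemma linear_form0 (R : realType) d (B : 'rV[R]_d -> R) : linear (B : _ -> R) -> B 0 = 0.
Proof.
by move=> Bl; have := Bl (-1) 0 0; rewrite scaler0 addr0 /GRing.scale/= mulN1r addNr.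
Qed.

Section Blocks.
Context {R : realType}.
Variables (d1 d2 : nat).

Lemma is_diff_row_mx (V : normedModType R) (f df : V -> 'rV[R]_d1)
    (g dg : V -> 'rV[R]_d2) x : is_diff x f df -> is_diff x g dg ->
  is_diff x (fun y => row_mx (f y) (g y)) (fun u => row_mx (df u) (dg u)).
Proof.
move=> fx gx.
have ll : linear (fun u : 'rV[R]_d1 => row_mx u (0 : 'rV[R]_d2)).
  by move=> a u v; rewrite scale_row_mx add_row_mx scaler0 addr0.
have rl : linear (fun u : 'rV[R]_d2 => row_mx (0 : 'rV[R]_d1) u).
  by move=> a u v; rewrite scale_row_mx add_row_mx scaler0 addr0.
pose lM := GRing.isLinear.Build _ _ _ _ _ ll.
pose rM := GRing.isLinear.Build _ _ _ _ _ rl.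
pose L : {linear _ -> _} := HB.pack (fun u : 'rV[R]_d1 => row_mx u (0 : 'rV[R]_d2)) lM.
pose Q : {linear _ -> _} := HB.pack (fun u : 'rV[R]_d2 => row_mx (0 : 'rV[R]_d1) u) rM.
have E (u : 'rV[R]_d1) (v : 'rV[R]_d2) : row_mx u v = L u + Q v.
  by rewrite add_row_mx addr0 add0r.
have := is_diffD (is_diff_comp fx (is_diff_linear L (f x)))
  (is_diff_comp gx (is_diff_linear Q (g x))).
under eq_fun do rewrite E.
by under [X in _ -> is_diff _ _ X]eq_fun do rewrite E.
Qed.

Lemma lsubmx_almost_product (u : 'rV[R]_(d1 + d2)) :
  lsubmx (almost_product u) = lsubmx u.
Proof. by rewrite /almost_product /projP /projQ linearB/= !row_mxKl subr0. Qed.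

Lemma rsubmx_almost_product (u : 'rV[R]_(d1 + d2)) :
  rsubmx (almost_product u) = - rsubmx u.
Proof. by rewrite /almost_product /projP /projQ linearB/= !row_mxKr sub0r. Qed.

Lemma almost_productK : involutive (@almost_product R d1 d2).
Proof.
move=> u; rewrite -[RHS]hsubmxK -[LHS]hsubmxK.
by rewrite !(lsubmx_almost_product, rsubmx_almost_product) opprK.
Qed.

Variables (B1 : 'rV[R]_d1 -> 'rV[R]_d1 -> 'rV[R]_d1 -> R).
Variables (B2 : 'rV[R]_d2 -> 'rV[R]_d2 -> 'rV[R]_d2 -> R).

(** For [s = 1] this is the product metric g1 + g2 in a product chart; for [s = -1] it is H = g1 -
    g2. Each summand depends only on its own block of the base point. *)
Definition block_form (s : R) (y u v : 'rV[R]_(d1 + d2)) : R :=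
  B1 (lsubmx y) (lsubmx u) (lsubmx v) + s * B2 (rsubmx y) (rsubmx u) (rsubmx v).

Hypothesis B1s : forall y u v, B1 y u v = B1 y v u.
Hypothesis B2s : forall y u v, B2 y u v = B2 y v u.
Hypothesis B1l : forall y v, linear (fun u => B1 y u v : R).
Hypothesis B2l : forall y v, linear (fun u => B2 y u v : R).

Lemma block_form_sym s y u v : block_form s y u v = block_form s y v u.
Proof. by rewrite /block_form B1s B2s. Qed.

Lemma block_form_linear s y v : linear (fun u => block_form s y u v : R).
Proof.
move=> a u u'; rewrite /block_form !linearP/= B1l B2l.
rewrite /GRing.scale/=; lra.
Qed.

(** [almost_product] negates the second block, and linearity moves that sign into [s]. At [s = 1]
    this reads g(u, F v) = H(u, v). *)
Lemma block_form_almost_product s y u v :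
  block_form s y u (almost_product v) = block_form (- s) y u v.
Proof.
rewrite /block_form lsubmx_almost_product rsubmx_almost_product.
congr (_ + _); rewrite (B2s _ _ (- _)) -[- rsubmx v]addr0 -scaleN1r.
rewrite B2l [in LHS]/GRing.scale/= (B2s _ _ (rsubmx u)).
rewrite (linear_form0 (B2l _ _)) addr0 /GRing.scale/=; lra.
Qed.

Lemma block_form_neq0 y u : (forall v, v != 0 -> 0 < B1 (lsubmx y) v v) ->
  (forall v, v != 0 -> 0 < B2 (rsubmx y) v v) -> u != 0 -> block_form 1 y u u != 0.
Proof.
move=> B1p B2p u0.
have [u1|u1] := eqVneq (lsubmx u) 0; last first.
  rewrite gt_eqF// /block_form mul1r ltr_pwDl ?B1p//.
  by have [->|u2] := eqVneq (rsubmx u) 0; [rewrite (linear_form0 (B2l _ _))|exact/ltW/B2p].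
have [u2|u2] := eqVneq (rsubmx u) 0.
  by rewrite -[u]hsubmxK u1 u2 row_mx0 eqxx in u0.
by rewrite gt_eqF// /block_form u1 (linear_form0 (B1l _ _)) add0r mul1r B2p.
Qed.

Variables (y : 'rV[R]_(d1 + d2)).
Hypothesis B1d : forall u v, differentiable (fun z => B1 z u v) (lsubmx y).
Hypothesis B2d : forall u v, differentiable (fun z => B2 z u v) (rsubmx y).

Lemma is_diff_block_form s u v :
  is_diff y (fun z => block_form s z u v) (fun w =>
    'd (fun z => B1 z (lsubmx u) (lsubmx v)) (lsubmx y) (lsubmx w)
    + s * 'd (fun z => B2 z (rsubmx u) (rsubmx v)) (rsubmx y) (rsubmx w)).
Proof.
apply: is_diffD.
  exact: is_diff_comp (is_diff_linear _ y) (differentiableP (B1d _ _)).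
apply: (@is_diffZ _ _ _ (fun z => B2 (rsubmx z) (rsubmx u) (rsubmx v))).
exact: is_diff_comp (is_diff_linear _ y) (differentiableP (B2d _ _)).
Qed.

Lemma block_form_differentiable s u v :
  differentiable (fun z => block_form s z u v) y.
Proof. exact: (@ex_diff _ _ _ _ _ _ _ (is_diff_block_form s u v)). Qed.

(* Hence the Levi-Civita connection of [B1 + B2] is also that of [B1 - B2]. *)
Lemma koszul_almost_product s u v w :
  koszul (block_form s) y u v (almost_product w) = koszul (block_form (- s)) y u v w.
Proof.
have E p q : (fun z => block_form s z p (almost_product q))
    = (fun z => block_form (- s) z p q).
  by apply/funext => z; exact: block_form_almost_product.
(* The derivative splits along the two blocks because neither form depends on the other base point.
   So F acting on the direction of differentiation again only changes the sign of [s]. *)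
have D : 'd (fun z => block_form s z u v) y (almost_product w)
    = 'd (fun z => block_form (- s) z u v) y w.
  have [_ /(congr1 (fun f => f (almost_product w))) ->] := is_diff_block_form s u v.
  have [_ /(congr1 (fun f => f w)) ->] := is_diff_block_form (- s) u v.
  by rewrite lsubmx_almost_product rsubmx_almost_product linearN/= mulNr mulrN.
exact: (f_equal3 (fun a b c : R => a + b - c) (congr1 (fun h => 'd h y u) (E v w))
  (congr1 (fun h => 'd h y v) (E u w)) D).
Qed.

End Blocks.

(** Linearity in the last slot allows the Koszul expression to be represented by a vector. *)
Lemma koszul_linear (R : realType) d (H : 'rV[R]_d -> 'rV[R]_d -> 'rV[R]_d -> R) y u v :
  (forall z p, linear (fun q => H z p q : R)) ->
  (forall p q, differentiable (fun z => H z p q) y) ->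
  linear (koszul H y u v : _ -> R).
Proof.
move=> Hl Hd.
have D a p q q' w : 'd (fun z => H z p (a *: q + q')) y w
    = a * 'd (fun z => H z p q) y w + 'd (fun z => H z p q') y w.
  have E := is_diffD (is_diffZ a (differentiableP (Hd p q))) (differentiableP (Hd p q')).
  rewrite (_ : (fun z => _) = a *: (fun z => H z p q) + (fun z => H z p q')).
    by case: E => _ /(congr1 (fun f => f w)).
  by apply/funext => z; exact: Hl.
move=> a w w'.
have E : 'd (fun z => H z u v) y (a *: w + w')
    = a * 'd (fun z => H z u v) y w + 'd (fun z => H z u v) y w' by exact: linearP.
have comb (x1 x2 x3 y1 y2 y3 z1 z2 z3 : R) : x1 = a * x2 + x3 ->
    y1 = a * y2 + y3 -> z1 = a * z2 + z3 ->
    x1 + y1 - z1 = a * (x2 + y2 - z2) + (x3 + y3 - z3).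
  by move=> -> -> ->; lra.
exact: comb (D a v w w' u) (D a u w w' v) E.
Qed.

(** Only first derivatives at [y] enter, so forms that agree near [y] have the same Koszul
    expression there. *)
Lemma near_eq_koszul (R : realType) d
    (H H' : 'rV[R]_d -> 'rV[R]_d -> 'rV[R]_d -> R) y u v w :
  (forall p q, differentiable (fun z => H z p q) y) ->
  (forall p q, \forall z \near y, H z p q = H' z p q) ->
  koszul H' y u v w = koszul H y u v w.
Proof.
move=> Hd HH'.
have E p q r : 'd (fun z => H' z p q) y r = 'd (fun z => H z p q) y r.
  by have [_ /(congr1 (fun f => f r))] := near_eq_is_diff (HH' p q) (differentiableP (Hd p q)).
exact: (f_equal3 (fun a b c : R => a + b - c) (E v w u) (E u w v) (E u v w)).
Qed.

(** * Metrics in charts *)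

Lemma chart_at_cod (R : realType) d (N : charted_space R d) (x : N) : is_manifold N ->
  [/\ is_chart (chart_at x), chart_cod (chart_at x) (Defs.coord x)
    & chart_inv (chart_at x) (Defs.coord x) = x].
Proof.
move=> [_ _ cN aN _]; have [ax xx] := aN x; have cx := cN _ ax.
by split => //; [exists x|have [_ _ + _ _] := cx; exact].
Qed.

Section Metric.
Context {R : realType}.
Variables (d : nat) (N : riem_space R d).

Lemma metric_in_linear (c : chart R N d) z v : is_riemannian N ->
  linear (fun u => metric_in c z u v : R).
Proof. by move=> [_ Nl _ _ _] a u u'; rewrite /metric_in/of_chart linearP Nl. Qed.

Lemma metric_in_sym (c : chart R N d) z u v : is_riemannian N ->
  metric_in c z u v = metric_in c z v u.
Proof. by move=> [_ _ Ns _ _]; exact: Ns. Qed.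

Lemma metric_in_differentiable (c : chart R N d) z u v : is_riemannian N ->
  atlas c -> chart_cod c z -> differentiable (fun y => metric_in c y u v) z.
Proof. by move=> [_ _ _ _ Nd] ac cz; have [+ _] := Nd c ac u v 1; exact. Qed.

Lemma metric_in_coord (x : N) u v : is_manifold N ->
  metric_in (chart_at x) (Defs.coord x) u v = metric x u v.
Proof.
move=> mN; have [cx xx xK] := chart_at_cod x mN.
have o w : of_chart (chart_at x) (Defs.coord x) w = w.
  by rewrite /of_chart xK; exact: diff_transition_id.
by rewrite /metric_in !o xK.
Qed.

(** The Riesz representation shows that the set inside [xget] is inhabited, so the default value 0
    is not what defines [christoffel] here. *)
Lemma christoffelP (c : chart R N d) z u v :
  (forall w, linear (fun p => metric_in c z p w : R)) ->
  (forall p, linear (fun w => metric_in c z p w : R)) ->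
  (forall p, p != 0 -> metric_in c z p p != 0) ->
  linear (koszul (metric_in c) z u v : _ -> R) ->
  forall w, metric_in c z (christoffel c z u v) w
            = 2^-1 * koszul (metric_in c) z u v w.
Proof.
move=> Bl Br Bn Kl.
have [|a aE] := @riesz_rV _ _ _ (fun w => 2^-1 * koszul (metric_in c) z u v w) Bl Br Bn.
  by move=> a w w'; rewrite Kl mulrDr -!/(_ *: _ : R^o) !scalerA mulrC.
rewrite /christoffel; case: xgetP => [b _ //|/(_ a)].
by case.
Qed.

End Metric.

(** * The product metric and the form H in product charts *)

Section ProductMetric.
Context {R : realType}.
Variables (d1 d2 : nat) (M1 : riem_space R d1) (M2 : riem_space R d2).

Lemma is_diff_transition_prod (e1 e1' : chart R M1 d1) (e2 e2' : chart R M2 d2) z :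
  differentiable (transition e1 e1') (lsubmx z) ->
  differentiable (transition e2 e2') (rsubmx z) ->
  is_diff z (transition (prod_chart e1 e2) (prod_chart e1' e2'))
    (fun u => row_mx ('d (transition e1 e1') (lsubmx z) (lsubmx u))
                     ('d (transition e2 e2') (rsubmx z) (rsubmx u))).
Proof.
move=> t1 t2; apply: is_diff_row_mx.
  exact: is_diff_comp (is_diff_linear _ z) (differentiableP t1).
exact: is_diff_comp (is_diff_linear _ z) (differentiableP t2).
Qed.

Hypothesis mM1 : is_manifold M1.
Hypothesis mM2 : is_manifold M2.

(** The preferred chart of the product is the product of the preferred charts, so the change to it
    has a block diagonal differential. *)
Lemma transition_chart_at_prod (e1 : chart R M1 d1) (e2 : chart R M2 d2) z :
  atlas e1 -> atlas e2 -> chart_cod e1 (lsubmx z) -> chart_cod e2 (rsubmx z) ->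
  is_diff z (transition (prod_chart e1 e2)
      (@chart_at _ _ (prod_riem M1 M2) (chart_inv (prod_chart e1 e2) z)))
    (fun u => row_mx (of_chart e1 (lsubmx z) (lsubmx u))
                     (of_chart e2 (rsubmx z) (rsubmx u))).
Proof.
move=> a1 a2 c1 c2; apply: is_diff_transition_prod.
  have [_ _ _ /(_ (chart_inv e1 (lsubmx z)))[? ?] _] := mM1.
  exact: transition_differentiable.
have [_ _ _ /(_ (chart_inv e2 (rsubmx z)))[? ?] _] := mM2.
exact: transition_differentiable.
Qed.

Lemma metric_in_prod (e1 : chart R M1 d1) (e2 : chart R M2 d2) z u v :
  atlas e1 -> atlas e2 -> chart_cod e1 (lsubmx z) -> chart_cod e2 (rsubmx z) ->
  @metric_in _ _ (prod_riem M1 M2) (prod_chart e1 e2) z u v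
  = block_form (metric_in e1) (metric_in e2) 1 z u v.
Proof.
move=> a1 a2 c1 c2; have [_ E] := transition_chart_at_prod a1 a2 c1 c2.
have o w := congr1 (fun g => g w) E.
rewrite /block_form mul1r /metric_in /=.
have -> : @of_chart _ _ (prod_riem M1 M2) (prod_chart e1 e2) z u = _ := o u.
have -> : @of_chart _ _ (prod_riem M1 M2) (prod_chart e1 e2) z v = _ := o v.
by rewrite !row_mxKl !row_mxKr.
Qed.

(** Changes between product charts preserve the splitting and so commute with F. Hence g1 - g2, read
    in any product chart, is g(F u, v) at the point. *)
Lemma block_form_metric (e1 : chart R M1 d1) (e2 : chart R M2 d2) z u v :
  is_riemannian M2 ->
  atlas e1 -> atlas e2 -> chart_cod e1 (lsubmx z) -> chart_cod e2 (rsubmx z) ->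
  let t := 'd (transition (prod_chart e1 e2)
      (@chart_at _ _ (prod_riem M1 M2) (chart_inv (prod_chart e1 e2) z))) z in
  block_form (metric_in e1) (metric_in e2) (-1) z u v
  = @metric _ _ (prod_riem M1 M2) (chart_inv (prod_chart e1 e2) z)
      (almost_product (t u)) (t v).
Proof.
move=> [_ M2l _ _ _] a1 a2 c1 c2 t.
have [_ E] := transition_chart_at_prod a1 a2 c1 c2.
have o w : t w = _ := congr1 (fun g => g w) E.
rewrite /block_form /metric_in /= !lsubmx_almost_product !rsubmx_almost_product.
rewrite !o !row_mxKl !row_mxKr; congr (_ + _).
rewrite -[- of_chart _ _ _]scaleN1r -[_ *: of_chart _ _ _]addr0 M2l.
by rewrite (linear_form0 (fun a p q => M2l _ a p q _)) addr0.
Qed.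

End ProductMetric.

(** * Vanishing of the second fundamental form *)

Theorem theorem4p1 (R : realType) (m n k : nat)
    (M1 : riem_space R (m + m)) (M2 : riem_space R (n + n))
    (M : charted_space R k) (f : M -> prod_riem M1 M2)
    (hM1 : is_kahler M1) (hM2 : is_kahler M2)
    (hM : is_manifold M) (hf : immersion f)
    (hF : F_anti_invariant f)
    (hs : forall (x : M) (V : 'rV[R]_((m + m) + (n + n))),
        is_normal f x V -> s_part f x V = 0) :
  totally_geodesic f.
Proof.
have [r1 _ _ _] := hM1; have [r2 _ _ _] := hM2; have [sf _] := hf.
have [m1 g1l _ g1p _] := r1; have [m2 g2l _ g2p _] := r2.
move=> U X Y _ _ sY x Ux.
pose c := chart_at x; pose e1 := chart_at (f x).1; pose e2 := chart_at (f x).2.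
pose e : chart R (prod_riem M1 M2) _ := prod_chart e1 e2.
pose z0 : 'rV[R]_k := Defs.coord x; pose phi := map_in f c e.
pose B1 := metric_in e1; pose B2 := metric_in e2.
pose G := block_form B1 B2 1; pose H := block_form B1 B2 (-1).
(* The chart properties of the product are obtained from those of the two Kähler factors. *)
have aN (q : prod_riem M1 M2) : atlas (chart_at q) /\ chart_dom (chart_at q) q.
  have [_ _ _ /(_ q.1)[? ?] _] := m1; have [_ _ _ /(_ q.2)[? ?] _] := m2.
  by split; [exists (chart_at q.1), (chart_at q.2)|].
have oN (q : prod_riem M1 M2) : open (chart_dom (chart_at q)).
  have [[P1 _ _ _ _] _ _] := chart_at_cod q.1 m1.
  have [[P2 _ _ _ _] _ _] := chart_at_cod q.2 m2.
  exact: open_setX.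
have KN (q p : prod_riem M1 M2) : chart_dom (chart_at q) p ->
    chart_inv (chart_at q) (chart_map (chart_at q) p) = p.
  have [[_ _ K1 _ _] _ _] := chart_at_cod q.1 m1.
  have [[_ _ K2 _ _] _ _] := chart_at_cod q.2 m2.
  case: p => p1 p2 [/= h1 h2].
  by rewrite /prod_chart/= row_mxKl row_mxKr K1// K2.
have [cc cz0 cK] := chart_at_cod x hM; rewrite -/c -/z0 in cc cz0 cK.
have [cc1 c1 _] := chart_at_cod (f x).1 m1; rewrite -/e1 in cc1 c1.
have [cc2 c2 _] := chart_at_cod (f x).2 m2; rewrite -/e2 in cc2 c2.
have [_ _ _ /(_ x)[ac cx] _] := hM; rewrite -/c in ac cx.
have [_ _ _ /(_ (f x).1)[a1 _] _] := m1; rewrite -/e1 in a1.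
have [_ _ _ /(_ (f x).2)[a2 _] _] := m2; rewrite -/e2 in a2.
have [ae ex] := aN (f x).
have phi0 : phi z0 = Defs.coord (f x) by rewrite /phi /map_in cK.
have l1 : lsubmx (phi z0) = Defs.coord (f x).1 by rewrite phi0 row_mxKl.
have l2 : rsubmx (phi z0) = Defs.coord (f x).2 by rewrite phi0 row_mxKr.
have B1x u v : B1 (lsubmx (phi z0)) u v = metric (f x).1 u v.
  by rewrite l1; exact: metric_in_coord.
have B2x u v : B2 (rsubmx (phi z0)) u v = metric (f x).2 u v.
  by rewrite l2; exact: metric_in_coord.
have ez0 : chart_dom e (f (chart_inv c z0)) by rewrite cK.
have phid : differentiable phi z0.
  exact: (map_in_differentiable hM sf ac ae cz0 (oN (f x)) ez0).
have [A Az CA] := map_in_smooth hM sf ac ae 2 cz0 (oN (f x)) ez0.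
have phidd v : differentiable (fun y => 'd phi y v) z0.
  by have [_ /(_ v)[+ _]] := CA; apply; exact: nbhs_singleton.
have sym u v : 'd (fun y => 'd phi y v) z0 u = 'd (fun y => 'd phi y u) z0 v.
  exact: hessian_sym Az CA.
have B1d u v : differentiable (fun y => B1 y u v) (lsubmx (phi z0)).
  by rewrite l1; exact: metric_in_differentiable.
have B2d u v : differentiable (fun y => B2 y u v) (rsubmx (phi z0)).
  by rewrite l2; exact: metric_in_differentiable.
have B1s y u v : B1 y u v = B1 y v u by exact: metric_in_sym.
have B2s y u v : B2 y u v = B2 y v u by exact: metric_in_sym.
have B1l y v : linear (fun u => B1 y u v : R) by exact: metric_in_linear.
have B2l y v : linear (fun u => B2 y u v : R) by exact: metric_in_linear.
have Hl y v := @block_form_linear _ _ _ B1 B2 B1l B2l (-1) y v.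
have Gs y u v : G y u v = G y v u by exact: block_form_sym.
have Gl y v := @block_form_linear _ _ _ B1 B2 B1l B2l 1 y v.
have Gr y u : linear (fun v => G y u v : R).
  by move=> a v v'; rewrite !(Gs y u); exact: Gl.
have Gd u v : differentiable (fun y => G y u v) (phi z0).
  exact: block_form_differentiable.
have Hd u v : differentiable (fun y => H y u v) (phi z0).
  exact: block_form_differentiable.
(* F-anti invariance at all points near [x], read in the fixed charts [c] and [e]. A whole
   neighbourhood is needed because the identity will be differentiated. *)
have null u v : \forall y \near z0, H (phi y) ('d phi y u) ('d phi y v) = 0.
  have : nbhs (chart_inv c z0) (f @^-1` chart_dom e).
    by rewrite cK; apply: sf.1; exact: open_nbhs_nbhs (conj (oN (f x)) ex).
  move=> /(near_chart_inv cc cz0); apply: filterS => y [cy dy ey].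
  have [ey1 ey2] := ey.
  have y1 : chart_cod e1 (lsubmx (phi y)).
    by exists (f (chart_inv c y)).1 => //; rewrite row_mxKl.
  have y2 : chart_cod e2 (rsubmx (phi y)).
    by exists (f (chart_inv c y)).2 => //; rewrite row_mxKr.
  have yE : chart_inv e (phi y) = f (chart_inv c y) by exact: KN ey.
  have [td _] := transition_chart_at_prod m1 m2 a1 a2 y1 y2.
  rewrite /H /B1 /B2 (block_form_metric m1 m2 _ _ r2 a1 a2 y1 y2).
  move: td; rewrite -/e yE => td.
  have T w := tmap_in_chart hM sf w ac ae cy aN (oN (f x)) ey (oN _) (KN (f x)) td.
  by rewrite -(T u) -(T v); apply: hF; eexists.
(* The product metric has block form wherever the chart [e] is valid; a neighbourhood of [phi z0] is
   enough for its Koszul expression. *)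
have near_G u v : \forall y \near phi z0,
    G y u v = @metric_in _ _ (prod_riem M1 M2) e y u v.
  have n1 : \forall y \near phi z0, chart_cod e1 (lsubmx y).
    by apply: continuous_lsubmx; rewrite l1; have [_ P1 _ _ _] := cc1; exact: open_nbhs_nbhs.
  have n2 : \forall y \near phi z0, chart_cod e2 (rsubmx y).
    by apply: continuous_rsubmx; rewrite l2; have [_ P1 _ _ _] := cc2; exact: open_nbhs_nbhs.
  apply: filterS2 n1 n2 => y y1 y2.
  by rewrite metric_in_prod.
have Gz0 u v : @metric_in _ _ (prod_riem M1 M2) e (phi z0) u v = G (phi z0) u v.
  exact/esym/(nbhs_singleton (near_G u v)).
have kG u v w : koszul (@metric_in _ _ (prod_riem M1 M2) e) (phi z0) u v w
    = koszul G (phi z0) u v w.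
  exact: near_eq_koszul.
pose U' := 'd phi z0 (X x); pose V' := 'd phi z0 (Y x).
pose Ga := @christoffel _ _ (prod_riem M1 M2) e (phi z0) U' V'.
have GaE w : G (phi z0) Ga w = 2^-1 * koszul G (phi z0) U' V' w.
  rewrite -Gz0 -kG; apply: christoffelP.
  - by move=> q a p p'; rewrite !Gz0; exact: Gl.
  - by move=> q a p p'; rewrite !Gz0; exact: Gr.
  - move=> p p0; rewrite Gz0; apply: block_form_neq0 => // [v v0|v v0].
      by rewrite B1x; exact: g1p.
    by rewrite B2x; exact: g2p.
  - by move=> a p p'; rewrite !kG; exact: koszul_linear.
(* Testing [GaE] on F of a tangent vector replaces G by H on both sides: the Christoffel vector of g
   obeys the Koszul identity of H. *)
have HGa w : H (phi z0) Ga ('d phi z0 w)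
    = 2^-1 * koszul H (phi z0) U' V' ('d phi z0 w).
  have GH : G (phi z0) Ga (almost_product ('d phi z0 w)) = H (phi z0) Ga ('d phi z0 w).
    exact: block_form_almost_product.
  rewrite -GH GaE; congr (_ * _); exact: koszul_almost_product.
pose Yc z := in_chart c (chart_inv c z) (Y (chart_inv c z)).
have Ycd : differentiable Yc z0.
  by have [+ _] := sY c ac 1; apply; exists x.
have Ycz0 : Yc z0 = Y x.
  by rewrite /Yc cK; exact: diff_transition_id.
(* Product rule for the local expression 'd phi z (Yc z) of the field f_* Y. *)
have YE := is_diff_linear_family
  (fun y => @linearP _ _ _ _ ('d phi y)) phidd (differentiableP Ycd).
pose w0 := 'd Yc z0 (X x).
pose D2 := 'd (fun y => 'd phi y (Y x)) z0 (X x).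
(* The ambient derivative is a second derivative of [phi], plus a vector tangent to the submanifold,
   plus the Christoffel term. *)
have ambE : ambient_deriv f X Y x = D2 + 'd phi z0 w0 + Ga.
  rewrite /ambient_deriv /Ga phi0; congr (_ + _).
  have [_ /(congr1 (fun g => g (X x))) YxE] := YE.
  by rewrite Ycz0 in YxE; exact: YxE.
have K0 w := @koszul_isotropic _ _ _ H phi z0 (X x) (Y x) w Hl
  (block_form_sym B1s B2s _) Hd phid phidd sym null.
(* The tangent term drops out because H vanishes on tangent vectors; the other two cancel by [K0]
   and [HGa]. *)
have Hamb w : H (phi z0) (D2 + 'd phi z0 w0 + Ga) ('d phi z0 w) = 0.
  have HD u v : H (phi z0) (u + v) ('d phi z0 w)
      = H (phi z0) u ('d phi z0 w) + H (phi z0) v ('d phi z0 w).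
    have := Hl (phi z0) ('d phi z0 w) 1 u v.
    by rewrite !scale1r.
  rewrite !HD HGa (nbhs_singleton (null w0 w)) addr0.
  have solve (a b : R) : 2 * a + b = 0 -> a + 2^-1 * b = 0 by move=> ?; lra.
  exact: solve (K0 w).
have FH u v : metric (f x) (almost_product u) v = H (phi z0) u v.
  rewrite /= lsubmx_almost_product rsubmx_almost_product.
  rewrite /H /block_form B1x B2x; congr (_ + _).
  rewrite -[- rsubmx _]scaleN1r -[_ *: rsubmx _]addr0 g2l.
  by rewrite (linear_form0 (fun a p q => g2l _ a p q _)) addr0.
(* The ambient derivative D is written as F (F D). By [Hamb] the vector F D is normal, so the normal
   part of F (F D) is its [s_part], which vanishes by [hs]. *)
rewrite /second_fundamental_form ambE -[X in nor_part _ _ X]almost_productK.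
apply: hs => w; exact: etrans (FH _ _) (Hamb w).
Qed.
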